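(* Let $G\subset\mathbb C$ be an additive subgroup that is free of rank $n\ge 1$, with $\mathbb Z$-basis $\epsilon_1=1,\epsilon_2,\dots,\epsilon_n$, such that $\frac1k\notin G$ for every integer $k>1$, and let $\lambda\in\mathbb C$ with $\lambda\neq-1$. Let $\overline{\mathfrak g}$ be the universal central extension of $\mathfrak g(G,\lambda)$. Then $\overline{\mathfrak g}$ is the Lie algebra spanned by $L_a, I_a$ ($a\in G$) together with central elements $C_L, C_I, C_{LI}^{(i)}$ ($0\le i\le n$), with Lie brackets, for $a=\sum_{i=1}^n a_i\epsilon_i\in G$ ($a_i\in\mathbb Z$) and $b\in G$, $$[L_a,L_b]=(b-a)L_{a+b}+\tfrac1{12}(a^3-a)\,C_L\,\delta_{a+b,0},\qquad [I_a,I_b]=a\,C_I\,\delta_{a+b,0}\,\delta_{\lambda,0},$$ $$[L_a,I_b]=(b-\lambda a)I_{a+b}+\delta_{a+b,0}\Big(C_{LI}^{(0)}(a^2+a)\delta_{\lambda,0}+\tfrac1{12}(a^3-a)C_{LI}^{(1)}\delta_{\lambda,1}+\sum_{i=2}^n a_i\,C_{LI}^{(i)}\,\delta_{\lambda,-2}\Big).$$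
   Context: For an additive subgroup $G\subseteq\mathbb C$ and $\lambda\in\mathbb C$, $\mathfrak g(G,\lambda)$ is the complex Lie algebra with basis $\{L_a,I_a\mid a\in G\}$ and brackets $[L_a,L_b]=(b-a)L_{a+b}$, $[L_a,I_b]=(b-\lambda a)I_{a+b}$, $[I_a,I_b]=0$. For $\lambda\ne-1$ it is perfect, so it has a universal central extension. Convention: a central symbol which only occurs multiplied by a vanishing Kronecker delta is omitted. That is, as a vector space $\overline{\mathfrak g}=\mathrm{span}\{L_a,I_a\mid a\in G\}\oplus\mathfrak c$, with basis the $L_a$, $I_a$ and the following central elements: $C_L$ always; additionally $C_I, C_{LI}^{(0)}$ if $\lambda=0$; $C_{LI}^{(1)}$ if $\lambda=1$; $C_{LI}^{(i)}$, $2\le i\le n$, if $\lambda=-2$. The covering map $\overline{\mathfrak g}\to\mathfrak g(G,\lambda)$ sends $L_a\mapsto L_a$, $I_a\mapsto I_a$ and kills $\mathfrak c$. *)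

(* Defs.v *)
From HB Require Import structures.
From mathcomp Require Import all_boot all_order all_algebra.
From mathcomp Require Import finmap complex reals ring.
From mathcomp.multinomials Require Import monalg.

Set Implicit Arguments.
Unset Strict Implicit.
Unset Printing Implicit Defensive.

Import Order.TTheory GRing.Theory Num.Theory.
Local Open Scope ring_scope.

HB.mixin Record isLieAlgebra (K : fieldType) V of GRing.Lmodule K V := {
  lie : V -> V -> V;
  lie_linearl : forall y : V, linear (fun x : V => lie x y);
  lie_linearr : forall x : V, linear (lie x);
  liexx : forall x : V, lie x x = 0;
  lie_jacobi : forall x y z : V,
    lie x (lie y z) + lie y (lie z x) + lie z (lie x y) = 0
}.

#[short(type="lieAlgType")]
HB.structure Definition LieAlgebra (K : fieldType) :=
  { V of isLieAlgebra K V & GRing.Lmodule K V }.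

Notation "[lie x , y ]" := (lie x y)
  (at level 0, x, y at level 99, format "[lie  x ,  y ]") : ring_scope.

Definition lie_morphism (K : fieldType) (E F : lieAlgType K)
    (f : {linear E -> F}) : Prop :=
  forall x y : E, f [lie x, y] = [lie f x, f y].

Definition lie_central (K : fieldType) (E : lieAlgType K) (z : E) : Prop :=
  forall x : E, [lie z, x] = 0.

Definition central_extension (K : fieldType) (E g : lieAlgType K)
    (p : {linear E -> g}) : Prop :=
  [/\ lie_morphism p,
      forall y : g, exists x : E, p x = y
    & forall z : E, p z = 0 -> lie_central z].

Definition universal_central_extension (K : fieldType) (E g : lieAlgType K)
    (p : {linear E -> g}) : Prop :=
  central_extension p /\
  forall (F : lieAlgType K) (q : {linear F -> g}), central_extension q ->
    exists f : {linear E -> F},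
      [/\ lie_morphism f, forall x : E, q (f x) = p x
        & forall f' : {linear E -> F},
            lie_morphism f' -> (forall x : E, q (f' x) = p x) -> f' =1 f].

(* {malg K[T]} is used only as the free K-module on T, with basis << t >>;   *)
(* its product is irrelevant here.                                           *)
Definition mcomb (K : fieldType) (T : choiceType) (V : lmodType K)
    (v : T -> V) (f : {malg K[T]}) : V :=
  \sum_(t <- msupp f) f@_t *: v t.

Definition is_basis (K : fieldType) (T : choiceType) (V : lmodType K)
    (v : T -> V) : Prop :=
  forall x : V, exists! f : {malg K[T]}, x = mcomb v f.

Section FreeModule.
Variables (K : fieldType) (T : choiceType).
Implicit Types (V : lmodType K) (f g : {malg K[T]}) (t : T).

Lemma mcombEw V (v : T -> V) (d : {fset T}) f : (msupp f `<=` d)%fset ->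
  mcomb v f = \sum_(t <- d) f@_t *: v t.
Proof.
move=> sfd; rewrite /mcomb; apply: big_fset_incl => // t _ tf.
by rewrite mcoeff_outdom ?scale0r.
Qed.

Lemma mcomb_linear V (v : T -> V) : linear (mcomb v).
Proof.
move=> c f g; pose d := (msupp f `|` msupp g `|` msupp (c *: f + g))%fset.
rewrite (@mcombEw _ v d f) ?(@mcombEw _ v d g) ?(@mcombEw _ v d) //.
- rewrite scaler_sumr -big_split; apply: eq_bigr => t _ /=.
  by rewrite mcoeffD mcoeffZ scalerDl scalerA.
- exact: fsubsetUr.
- by rewrite /d -fsetUA fsetUCA fsubsetUl.
- by rewrite /d -fsetUA fsubsetUl.
Qed.

Lemma mcombU V (v : T -> V) t : mcomb v << t >> = v t.
Proof. by rewrite /mcomb msuppU oner_eq0 big_seq_fset1 mcoeffUU scale1r. Qed.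

Lemma malg_linear0 V (F : {malg K[T]} -> V) :
  linear F -> (forall t, F << t >> = 0) -> forall f, F f = 0.
Proof.
move=> linF F0 f.
have F00 : F 0 = 0 by have := linF (-1) 0 0; rewrite scaler0 addr0 scaleN1r addNr.
rewrite (monalgE f); elim: (enum_fset _) => [|t s IHs]; first by rewrite big_nil.
rewrite big_cons.
have -> : << f@_t *g t >> = f@_t *: << t >>.
  by apply/malgP=> u; rewrite mcoeffZ !mcoeffU; case: eqP; rewrite ?mulr1 ?mulr0.
by rewrite linF IHs F0 scaler0 addr0.
Qed.

End FreeModule.

Section StructureConstants.
Variables (K : numFieldType) (T : choiceType) (br : T -> T -> {malg K[T]}).

Definition malg_lie (x y : {malg K[T]}) : {malg K[T]} :=
  mcomb (fun s => mcomb (br s) y) x.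

Lemma malg_lie_linearl y : linear (fun x => malg_lie x y).
Proof. exact: mcomb_linear. Qed.

Lemma malg_lie_linearr x : linear (malg_lie x).
Proof.
move=> c y z; rewrite /malg_lie /mcomb scaler_sumr -big_split.
apply: eq_bigr => s _ /=.
by rewrite -!/(mcomb _ _) mcomb_linear scalerDr !scalerA mulrC.
Qed.

Lemma malg_lieU s t : malg_lie << s >> << t >> = br s t.
Proof. by rewrite /malg_lie !mcombU. Qed.

Lemma malg_lie0r x : malg_lie x 0 = 0.
Proof.
by have := malg_lie_linearr x (-1) 0 0; rewrite scaler0 addr0 scaleN1r addNr.
Qed.

Lemma malg_lieZU s t (c : K) : malg_lie << s >> (c *: << t >>) = c *: br s t.
Proof.
by rewrite -malg_lieU -[c *: << t >>]addr0 malg_lie_linearr malg_lie0r addr0.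
Qed.

Hypothesis anti : forall s t, br s t + br t s = 0.

Lemma malg_lie_anti x y : malg_lie x y + malg_lie y x = 0.
Proof.
move: x; apply: malg_linear0 => [c u v|s].
  rewrite malg_lie_linearl malg_lie_linearr scalerDr; exact: addrACA.
move: y; apply: malg_linear0 => [c u v|t].
  rewrite malg_lie_linearl malg_lie_linearr scalerDr; exact: addrACA.
by rewrite !malg_lieU.
Qed.

Lemma malg_liexx x : malg_lie x x = 0.
Proof.
set z := malg_lie x x.
have z2 : (1 + 1 : K) *: z = 0 by rewrite scalerDl scale1r; exact: malg_lie_anti.
have two0 : (1 + 1 : K) != 0 by rewrite -mulr2n pnatr_eq0.
by rewrite -[z]scale1r -(mulVf two0) -scalerA z2 scaler0.
Qed.

Hypothesis jac : forall r s t,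
  malg_lie << r >> (br s t) + malg_lie << s >> (br t r)
  + malg_lie << t >> (br r s) = 0.

Lemma malg_lie_jacobi x y z :
  malg_lie x (malg_lie y z) + malg_lie y (malg_lie z x)
  + malg_lie z (malg_lie x y) = 0.
Proof.
have ac (a b c a' b' c' : {malg K[T]}) (k : K) :
    (k *: a + a') + (k *: b + b') + (k *: c + c') =
    k *: (a + b + c) + (a' + b' + c').
  by rewrite !scalerDr [RHS]addrACA; congr (_ + _); exact: addrACA.
move: x; apply: malg_linear0 => [k u v|r].
  by rewrite !(malg_lie_linearl, malg_lie_linearr) ac.
move: y; apply: malg_linear0 => [k u v|s].
  by rewrite !(malg_lie_linearl, malg_lie_linearr) ac.
move: z; apply: malg_linear0 => [k u v|t].
  by rewrite !(malg_lie_linearl, malg_lie_linearr) ac.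
by rewrite !malg_lieU jac.
Qed.

End StructureConstants.

Definition subgroup (V : zmodType) (G : zmodClosed V) : Type := {x : V | x \in G}.

HB.instance Definition _ (V : zmodType) (G : zmodClosed V) :=
  [isSub of subgroup G for @sval _ _].
HB.instance Definition _ (V : zmodType) (G : zmodClosed V) :=
  [Choice of subgroup G by <:].
HB.instance Definition _ (V : zmodType) (G : zmodClosed V) :=
  [SubChoice_isSubZmodule of subgroup G by <:].

Definition is_Zbasis (A : zmodType) (n : nat) (eps : 'I_n -> A) : Prop :=
  forall a : A, exists! c : {ffun 'I_n -> int}, a = \sum_(i < n) eps i *~ c i.

(* The carrier of g(G, lam) does not depend on lam, but its bracket does.    *)
Definition gLie (K : numFieldType) (G : zmodClosed K) (lam : K) : Type :=
  {malg K[(subgroup G + subgroup G)%type]}.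

HB.instance Definition _ (K : numFieldType) (G : zmodClosed K) (lam : K) :=
  GRing.Lmodule.on (gLie G lam).

Definition gL (K : numFieldType) (G : zmodClosed K) (lam : K)
  (a : subgroup G) : gLie G lam := << inl a >>.
Definition gI (K : numFieldType) (G : zmodClosed K) (lam : K)
  (a : subgroup G) : gLie G lam := << inr a >>.

Section AlgebraG.
Variables (K : numFieldType) (G : zmodClosed K) (lam : K).
Local Notation gLie := (gLie G lam).
Local Notation gL := (@gL K G lam).
Local Notation gI := (@gI K G lam).

Definition g_br (s t : (subgroup G + subgroup G)%type) : gLie :=
  match s, t with
  | inl a, inl b => (val b - val a) *: gL (a + b)
  | inl a, inr b => (val b - lam * val a) *: gI (a + b)
  | inr a, inl b => - ((val a - lam * val b) *: gI (b + a))
  | inr _, inr _ => 0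
  end.

Lemma g_br_anti s t : g_br s t + g_br t s = 0.
Proof.
case: s t => [] a [] b; rewrite /g_br ?addrN ?addNr ?addr0 //.
rewrite [b + a]addrC -scalerDl addrA.
by rewrite subrK subrr scale0r.
Qed.

Let ix (s : (subgroup G + subgroup G)%type) : subgroup G :=
  match s with inl a => a | inr a => a end.

Let cf (s t : (subgroup G + subgroup G)%type) : K :=
  match s, t with
  | inl a, inl b => val b - val a
  | inl a, inr b => val b - lam * val a
  | inr a, inl b => - (val a - lam * val b)
  | inr _, inr _ => 0
  end.

Let tg (s t : (subgroup G + subgroup G)%type) : (subgroup G + subgroup G)%type :=
  match s, t with
  | inl a, inl b => inl (a + b)
  | _, _ => inr (ix s + ix t)
  end.

Let g_brE s t : g_br s t = cf s t *: << tg s t >>.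
Proof.
by case: s t => [] a [] b; rewrite /g_br /cf ?scale0r // scaleNr [b + a]addrC.
Qed.

Let tgAC r s t : tg s (tg t r) = tg r (tg s t).
Proof.
by case: r s t => [] a [] b [] c /=; first [congr inl | congr inr];
  rewrite addrA [LHS]addrC.
Qed.

Let cfJ r s t : cf s t * cf r (tg s t) + cf t r * cf s (tg t r)
  + cf r s * cf t (tg r s) = 0.
Proof. by case: r s t => [] a [] b [] c; rewrite /cf /tg /= ; ring. Qed.

Lemma g_br_jacobi r s t :
  malg_lie g_br << r >> (g_br s t) + malg_lie g_br << s >> (g_br t r)
  + malg_lie g_br << t >> (g_br r s) = 0.
Proof.
rewrite (g_brE s t) (g_brE t r) (g_brE r s) !malg_lieZU.
rewrite (g_brE r) (g_brE s) (g_brE t) !scalerA.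
by rewrite (tgAC r s t) -(tgAC t r s) -!scalerDl cfJ scale0r.
Qed.

HB.instance Definition _ := isLieAlgebra.Build K gLie
  (malg_lie_linearl g_br) (malg_lie_linearr g_br)
  (malg_liexx g_br_anti) (malg_lie_jacobi g_br_jacobi).

Lemma gLL a b : [lie gL a, gL b] = (val b - val a) *: gL (a + b).
Proof. exact: malg_lieU. Qed.

Lemma gLI a b : [lie gL a, gI b] = (val b - lam * val a) *: gI (a + b).
Proof. exact: malg_lieU. Qed.

Lemma gII a b : [lie gI a, gI b] = 0.
Proof. exact: malg_lieU. Qed.

End AlgebraG.

(* CLI i is the symbol C_LI^(i), 0 <= i <= n. A Z-basis eps : 'I_n -> _ is    *)
(* numbered from 0, so CLI i.+1 goes with the coordinate along eps i.        *)
Inductive central (n : nat) : Type := CL | CI | CLI of 'I_n.+1.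
Arguments CL {n}.
Arguments CI {n}.

Definition central_code n (c : central n) : option (option 'I_n.+1) :=
  match c with CL => None | CI => Some None | CLI i => Some (Some i) end.

Definition central_decode n (o : option (option 'I_n.+1)) : central n :=
  match o with None => CL | Some None => CI | Some (Some i) => CLI i end.

Lemma central_codeK n : cancel (@central_code n) (@central_decode n).
Proof. by case. Qed.

HB.instance Definition _ n := Choice.copy (central n) (can_type (@central_codeK n)).

(* Whether a central symbol is present: those which only ever occur with a   *)
(* vanishing Kronecker delta are omitted.                                    *)
Definition present (K : numFieldType) (lam : K) (n : nat) (c : central n) : bool :=
  match c with
  | CL => true
  | CI => lam == 0
  | CLI i => match val i with
             | 0%N => lam == 0
             | 1%N => lam == 1
             | _ => lam == - 2
             end
  end.

Definition gbar_family (K : numFieldType) (G : zmodClosed K) (lam : K) (n : nat)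
    (E : Type) (L I : subgroup G -> E) (C : central n -> E)
    (t : (subgroup G + subgroup G) + {c : central n | present lam c}) : E :=
  match t with
  | inl (inl a) => L a
  | inl (inr a) => I a
  | inr c => C (val c)
  end.

(* Main.v *)
Require Import Defs.
From HB Require Import structures.
From mathcomp Require Import all_boot all_order all_algebra.
From mathcomp Require Import complex reals ring.
From mathcomp.multinomials Require Import monalg.

(** The brackets of g = g(G, lam) are graded by G, and L_0 acts on the degree a
part as multiplication by a. Let q : F -> g be a central extension. Brackets
in F depend only on the images of the two arguments in g, so every basis vector
s of g has a preferred lift, obtained by writing s as a multiple of a bracket
[r, t] and bracketing arbitrary lifts of r and t ([root_pair]): r = L_0 when s
has nonzero degree, and r = L_{-1} with t in degree 1 when s has degree 0. The
latter is possible because lam <> -1. The failure D s t of these lifts to be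
compatible with the bracket is a 2-cocycle with central values that vanishes on
all root pairs.

Such a normalised cocycle is determined by elementary means. The Jacobi
identity with L_0 kills D s t unless the degrees of s and t are opposite. What
remains is f(a) = D(L_a, X_{-a}) for X = L or I, and D(I_a, I_{-a}). The Jacobi
identity of L_a, L_b, X_{-a-b} says that f solves

  (b - a) f(a+b) = (a + b + mu a) f(b) - (a + b + mu b) f(a),   f(-1) = 0,

with mu = 1 for X = L and mu = lam for X = I. Setting b = 1 and b = -1 and
eliminating f(a-1) leaves

  (1 - mu) (2 + mu) f(a) = (a + 1) ((1 + mu) a - mu) f(1),

so only mu = 0 (multiples of a^2 + a), mu = 1 (multiples of a^3 - a) and
mu = -2 (additive functions with f(1) = 0, whence one free value for each of
eps_2, ..., eps_n) allow f <> 0. Therefore every D is the combination of the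
listed scalar cocycles whose coefficients are the values of D on one chosen pair
of basis vectors per cocycle ([normalised_cocycle_expand]); in other words, every
central extension contains lifts L, I and central elements C obeying the
displayed brackets ([central_extension_realizes]).

Conversely, these brackets define a Lie algebra [cover] with the asserted basis.
By the previous paragraph it maps to every central extension, and the map is
unique because each basis vector of [cover] is obtained from brackets: the lifts
from root pairs, the central ones from the chosen pairs. So [cover] is universal
([cover_universal]), and any other universal central extension is isomorphic to
it over g, which transports the basis and the brackets. *)

Set Implicit Arguments.
Unset Strict Implicit.
Unset Printing Implicit Defensive.

Import Order.TTheory GRing.Theory Num.Theory.
Local Open Scope ring_scope.

(** * The functional equation of the degree 0 part *)

Section FunctionalEquation.
Variables (K : numFieldType) (A : zmodType) (v : {additive A -> K}).
Hypothesis v_inj : injective v.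
Variables (one : A) (one1 : v one = 1).
Variables (V : lmodType K) (mu : K) (f : A -> V).

(** The Jacobi identity of L_a, L_b, X_{-a-b} for the central value f(a) of
[L_a, X_{-a}], where [L_a, X_b] = (b - mu a) X_{a+b}. *)
Definition cocycle_equation := forall a b : A,
  (v b - v a) *: f (a + b) =
  (v a + v b + mu * v a) *: f b - (v a + v b + mu * v b) *: f a.

Hypothesis fE : cocycle_equation.

Lemma equation_at0 : mu != -1 -> f 0 = 0.
Proof.
move=> mu1; have := fE one 0; rewrite addr0 raddf0 one1 mulr0 mulr1 !addr0.
rewrite sub0r scale1r scaleN1r => /eqP; rewrite -subr_eq opprK addNr eq_sym.
by rewrite scaler_eq0 addrC addr_eq0 (negPf mu1) => /eqP.
Qed.

Lemma scale_eq_sub (c1 c2 c3 : K) (u w : V) :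
  c1 *: u = c2 *: u - c3 *: w -> (c2 - c1) *: u = c3 *: w.
Proof. by rewrite scalerBl => ->; rewrite opprB addrC subrK. Qed.

Hypothesis fN1 : f (- one) = 0.

(** The cases b = -1 and b = 1 of the equation relate f(a) to f(a-1) in two
ways; this is the result of eliminating f(a-1). *)
Lemma equation_quadratic a :
  ((1 - mu) * (2 + mu)) *: f a =
  ((v a + 1) * ((1 + mu) * v a - mu)) *: f one.
Proof.
have e1 : (v a + 1) *: f (a - one) = (v a - 1 - mu) *: f a.
  have := fE a (- one); rewrite fN1 scaler0 sub0r ?(raddfD v, raddfN v) one1 mulrN1.
  by move/(congr1 -%R); rewrite opprK -scaleNr opprB opprK.
have e2 := fE one (a - one).
rewrite addrCA subrr addr0 ?(raddfD v, raddfN v) one1 mulr1 in e2.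
have := congr1 (fun u => (v a + 1) *: u) e2.
rewrite /= scalerBr !scalerA [(v a + 1) * (1 + _ + mu)]mulrC.
rewrite -[_ *: f (a - one)]scalerA.
rewrite e1 scalerA => /scale_eq_sub e3.
rewrite (_ : (1 - mu) * _ = (1 + (v a - 1) + mu) * (v a - 1 - mu) -
   (v a + 1) * (v a - 1 - 1)); last by ring.
by rewrite e3; congr (_ *: _); ring.
Qed.

Lemma equation_one0 : mu != 0 -> mu != -1 -> f one = 0.
Proof.
move=> mu0 mu1; have := equation_quadratic 0.
rewrite raddf0 equation_at0 // scaler0 mulr0 !add0r mul1r => /esym/eqP.
by rewrite scaler_eq0 oppr_eq0 (negPf mu0) => /eqP.
Qed.

Lemma equation_generic a :
  mu != 0 -> mu != -1 -> mu != 1 -> mu != - 2 -> f a = 0.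
Proof.
move=> mu0 mu1 mu2 mu3; have := equation_quadratic a.
rewrite equation_one0 // scaler0 => /eqP; rewrite scaler_eq0 mulf_eq0.
by rewrite subr_eq0 eq_sym (negPf mu2) addrC addr_eq0 (negPf mu3) => /eqP.
Qed.

Lemma equation_mu0 a : mu = 0 -> f a = ((v a ^+ 2 + v a) / 2) *: f one.
Proof.
move=> mu0; have := equation_quadratic a; rewrite mu0 subr0 !addr0 !mul1r subr0.
move/(congr1 (fun u => 2^-1 *: u)); rewrite !scalerA mulVf ?pnatr_eq0 // scale1r.
by move=> ->; congr (_ *: _); ring.
Qed.

(** For mu = 1 the quadratic relation only gives f(1) = 0. Now f(a), f(a+1) and
f(a+2) are linked by adding 1 twice, and f(a) and f(a+2) by adding 2; the
elimination leaves 12 f(a) = 2 (a^3 - a) f(2). *)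
Lemma equation_mu1 a :
  mu = 1 -> f a = ((v a ^+ 3 - v a) / 6) *: f (one + one).
Proof.
move=> mu1; have f1 : f one = 0.
  by apply: equation_one0; rewrite mu1 ?oner_eq0 // -subr_eq0 opprK -mulr2n pnatr_eq0.
have fE1 (b c : A) : (v c - v b) *: f (b + c) =
    (2 * v b + v c) *: f c - (v b + 2 * v c) *: f b.
  by rewrite fE mu1; congr (_ *: _ - _ *: _); ring.
have e1 := fE1 one a; have e2 := fE1 one (one + a); rewrite addrA in e2.
have e3 := fE1 (one + one) a.
rewrite f1 !scaler0 !subr0 in e1 e2.
rewrite ?(raddfD v, raddfN v) !one1 in e1 e2 e3.
have := congr1 (fun u => (v a * (v a - 1)) *: u) e3.
rewrite /= scalerBr !scalerA.
rewrite (_ : _ * (_ - (1 + 1)) = (v a - 1) * (v a - 2) * (1 + v a - 1)); last by ring.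
rewrite -scalerA e2 scalerA.
rewrite (_ : _ * (2 * 1 + _) = (v a - 2) * (v a + 3) * (v a - 1)); last by ring.
rewrite -scalerA e1 scalerA => /scale_eq_sub.
rewrite (_ : _ - _ = 12); last by ring.
move/(congr1 (fun u => 12^-1 *: u)).
rewrite !scalerA mulVf ?pnatr_eq0 // scale1r => ->.
by congr (_ *: _); field.
Qed.

(** For mu = -2 the equation is (b - a) (f(a+b) - f(a) - f(b)) = 0. Only the
diagonal needs an argument: f(4a) = f(2a) + 2 f(a) by successive additions of
distinct elements, while f(2a) = f(4a) - f(2a). *)
Lemma equation_additive : mu = - 2 -> {morph f : a b / a + b}.
Proof.
move=> mu2.
have f0 : f 0 = 0.
  by apply: equation_at0; rewrite mu2 eqr_opp -subr_eq0 -[2]/(1 + 1) addrK oner_eq0.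
have neqD a b : a != b -> f (a + b) = f a + f b.
  move=> ab; apply: (@scalerI _ _ (v b - v a)).
    by rewrite subr_eq0 (inj_eq v_inj) eq_sym.
  rewrite fE mu2 scalerDr -scaleNr [LHS]addrC.
  by congr (_ *: _ + _ *: _); ring.
have fN a : f (- a) = - f a.
  have [aa|/neqD] := eqVneq (- a) a; last first.
    by rewrite addNr f0 => /esym/eqP; rewrite addr_eq0 => /eqP.
  suff -> : a = 0 by rewrite oppr0 f0 oppr0.
  move/(congr1 v)/eqP: aa; rewrite raddfN eq_sym -addr_eq0 -mulr2n mulrn_eq0 /=.
  by rewrite -(raddf0 v) (inj_eq v_inj) => /eqP.
move=> a b; have [<-|] := eqVneq a b; last exact: neqD.
have [->|a0] := eqVneq a 0; first by rewrite addr0 f0 addr0.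
have neqMn (i j : nat) : i != j -> a *+ i != a *+ j.
  move=> ij; rewrite -(inj_eq v_inj) !raddfMn (inj_eq (mulrIn _)) //.
  by rewrite -(raddf0 v) (inj_eq v_inj).
have f4 : f (a *+ 4) = f (a *+ 2) + f a + f a.
  rewrite (mulrSr a 3) neqD; last exact: (neqMn 3 1)%N.
  by rewrite (mulrSr a 2) neqD; last exact: (neqMn 2 1)%N.
have /neqD : a *+ 4 != - (a *+ 2).
  by rewrite -addr_eq0 -mulrnDr -(mulr0n a) neqMn.
by rewrite -mulrnBr // mulr2n f4 mulr2n fN => ->; rewrite addrC !addrA addNr add0r.
Qed.
End FunctionalEquation.

(** * Lie algebras, free modules and central extensions *)

Section LieGeneralities.
Variables (K : fieldType) (E : lieAlgType K).
Implicit Types x y z : E.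

HB.instance Definition _ x :=
  GRing.isLinear.Build K E E *:%R (lie x) (lie_linearr x).

Lemma lieDr x y z : [lie x, y + z] = [lie x, y] + [lie x, z].
Proof. exact: (linearD (lie x)). Qed.

Lemma lieZr c x z : [lie x, c *: z] = c *: [lie x, z].
Proof. exact: (linearZZ (lie x)). Qed.

Lemma lie0r x : [lie x, 0] = 0.
Proof. exact: (linear0 (lie x)). Qed.

Lemma lieC x y : [lie x, y] = - [lie y, x].
Proof.
have lieDl u u' z : [lie u + u', z] = [lie u, z] + [lie u', z].
  by have := lie_linearl z 1 u u'; rewrite /= !scale1r.
apply/eqP; rewrite -addr_eq0; have := liexx (x + y).
by rewrite lieDl !lieDr !liexx add0r addr0 => /eqP.
Qed.

Lemma lieDl x y z : [lie x + y, z] = [lie x, z] + [lie y, z].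
Proof. by rewrite lieC lieDr opprD -!(lieC _ z). Qed.

Lemma lie0l z : [lie 0, z] = 0.
Proof. by rewrite lieC lie0r oppr0. Qed.

Lemma central_lier x z : lie_central z -> [lie x, z] = 0.
Proof. by move=> cz; rewrite lieC cz oppr0. Qed.

End LieGeneralities.

HB.instance Definition _ (K : fieldType) (T : choiceType) (V : lmodType K)
    (v : T -> V) :=
  GRing.isLinear.Build K {malg K[T]} V *:%R (mcomb v) (mcomb_linear v).

HB.instance Definition _ (K : numFieldType) (T : choiceType)
    (br : T -> T -> {malg K[T]}) (x : {malg K[T]}) :=
  GRing.isLinear.Build K {malg K[T]} {malg K[T]} *:%R (malg_lie br x)
    (malg_lie_linearr br x).

Lemma malg_linear_eq (K : fieldType) (T : choiceType) (V : lmodType K)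
    (f g : {malg K[T]} -> V) :
  linear f -> linear g -> (forall t, f << t >> = g << t >>) -> f =1 g.
Proof.
move=> lf lg fg x; apply/eqP; rewrite -subr_eq0; apply/eqP; move: x.
apply: (@malg_linear0 _ _ _ (fun x => f x - g x)) => [c x y|t].
  by rewrite lf lg scalerBr opprD addrACA.
by rewrite fg subrr.
Qed.

Lemma linear_extension_term (K : fieldType) (V W : lmodType K)
    (f : {linear V -> W}) (a : K) (v : V) (I : Type) (r : seq I) (b : I -> K)
    (C : I -> V) :
  f (a *: v + \sum_(i <- r) b i *: C i) =
  a *: f v + \sum_(i <- r) b i *: f (C i).
Proof.
rewrite linearD linearZ linear_sum; congr (_ + _).
by apply: eq_bigr => i _; rewrite linearZ.
Qed.

(** A bracket in a central extension depends only on the images of its two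
arguments: this is what makes lifts of brackets canonical. *)
Section CentralExtensions.
Variables (K : fieldType) (E g : lieAlgType K) (p : {linear E -> g}).
Hypothesis p_ext : central_extension p.

Lemma ext_lie_congl (x x' y : E) : p x = p x' -> [lie x, y] = [lie x', y].
Proof.
move=> pxx'; have [_ _ ker_p] := p_ext.
rewrite -[x](subrK x') lieDl ker_p ?add0r //.
by rewrite linearB pxx' subrr.
Qed.

Lemma ext_lie_congr (x y y' : E) : p y = p y' -> [lie x, y] = [lie x, y'].
Proof. by move=> pyy'; rewrite lieC (ext_lie_congl _ pyy') -lieC. Qed.

End CentralExtensions.

(** Two morphisms that lift the same map differ by central elements, hence agree
on brackets; on a perfect algebra this forces them to be equal. *)
Lemma ext_morphism_lie_eq (K : fieldType) (E F g : lieAlgType K)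
  (q : {linear F -> g}) (q_ext : central_extension q)
  (f f' : {linear E -> F}) : lie_morphism f -> lie_morphism f' ->
  (forall x, q (f x) = q (f' x)) ->
  forall x y, f [lie x, y] = f' [lie x, y].
Proof.
move=> fM f'M qff' x y; rewrite fM f'M.
by rewrite (ext_lie_congl q_ext _ (qff' x)) (ext_lie_congr q_ext _ (qff' y)).
Qed.

Lemma universal_central_extension_iso (K : fieldType) (E F g : lieAlgType K)
    (p : {linear E -> g}) (q : {linear F -> g}) :
  universal_central_extension p -> universal_central_extension q ->
  exists (f : {linear E -> F}) (f' : {linear F -> E}),
    [/\ lie_morphism f, forall x, q (f x) = p x, cancel f f' & cancel f' f].
Proof.
move=> [p_ext p_univ] [q_ext q_univ].
have [f [fM qf _]] := p_univ F q q_ext.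
have [f' [f'M pf' _]] := q_univ E p p_ext.
exists f, f'; split=> // x.
  have [h [_ _ h_uniq]] := p_univ E p p_ext.
  rewrite -[RHS](_ : idfun x = x) // (h_uniq idfun) //.
  rewrite -(h_uniq (f' \o f)) //= => [y z|y] /=; first by rewrite fM f'M.
  by rewrite pf' qf.
have [h [_ _ h_uniq]] := q_univ F q q_ext.
rewrite -[RHS](_ : idfun x = x) // (h_uniq idfun) //.
rewrite -(h_uniq (f \o f')) //= => [y z|y] /=; first by rewrite f'M fM.
by rewrite qf pf'.
Qed.

(** * The scalar cocycles *)

Definition central_enum n : seq (central n) :=
  CL :: CI :: [seq CLI i | i <- enum 'I_n.+1].

Lemma central_enum_uniq n : uniq (central_enum n).
Proof.
rewrite /central_enum /= in_cons negb_or map_inj_uniq ?enum_uniq ?andbT; last first.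
  by move=> i j [].
by apply/andP; split; apply/mapP => -[].
Qed.

Lemma mem_central_enum n (c : central n) : c \in central_enum n.
Proof.
by case: c => [||i]; rewrite !in_cons //= map_f ?orbT // mem_enum.
Qed.

Lemma big_central n (V : nmodType) (F : central n -> V) :
  \sum_(c <- central_enum n) F c =
  F CL + (F CI + \sum_(i < n.+1) F (CLI i)).
Proof.
by rewrite !big_cons big_map big_enum; congr (_ + (_ + _)); exact: eq_bigl.
Qed.

Section Cocycles.
Variables (K : numFieldType) (G : zmodClosed K) (n : nat) (hn : (0 < n)%N).
Variables (eps : 'I_n -> subgroup G) (eps_basis : is_Zbasis eps).
Hypothesis eps1 : val (eps (Ordinal hn)) = 1.
Variable lam : K.

Local Notation S := (subgroup G + subgroup G)%type.
Local Notation one := (eps (Ordinal hn)).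
Implicit Types (a b : subgroup G) (r s t : S) (c : central n).

(** The inclusion of G in K, named so that it is a single atom for [ring] and
[field]. *)
Definition emb : {additive subgroup G -> K} := val.
Arguments emb : simpl never.

Lemma emb0 : emb 0 = 0. Proof. exact: raddf0. Qed.
Lemma embD a b : emb (a + b) = emb a + emb b. Proof. exact: raddfD. Qed.
Lemma embN a : emb (- a) = - emb a. Proof. exact: raddfN. Qed.
Lemma emb_inj : injective emb. Proof. exact: val_inj. Qed.
Lemma emb_one : emb one = 1. Proof. exact: eps1. Qed.

Lemma coord_ex a : exists m : {ffun 'I_n -> int}, a == \sum_(i < n) eps i *~ m i.
Proof. by have [m [/eqP am _]] := eps_basis a; exists m. Qed.

Definition coord a : {ffun 'I_n -> int} := xchoose (coord_ex a).

Lemma coordP a : a = \sum_(i < n) eps i *~ coord a i.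
Proof. exact/eqP/(xchooseP (coord_ex a)). Qed.

Lemma coord_uniq a (m : {ffun _}) : a = \sum_(i < n) eps i *~ m i -> coord a = m.
Proof.
have [m' [_ uniq_m']] := eps_basis a.
by move=> /uniq_m' <-; rewrite (uniq_m' _ (coordP a)).
Qed.

Lemma coordB a b j : coord (a - b) j = coord a j - coord b j.
Proof.
rewrite (@coord_uniq _ [ffun i => coord a i - coord b i]) ?ffunE //.
rewrite {1}(coordP a) {1}(coordP b) -sumrB.
by apply: eq_bigr => i _; rewrite ffunE mulrzBr.
Qed.

Lemma coord0 j : coord 0 j = 0.
Proof. by rewrite -(subrr 0) coordB subrr. Qed.

Lemma coordN a j : coord (- a) j = - coord a j.
Proof. by rewrite -sub0r coordB coord0 sub0r. Qed.

Lemma coordD a b j : coord (a + b) j = coord a j + coord b j.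
Proof. by rewrite -[b]opprK coordB !coordN !opprK. Qed.

Lemma coord_eps i j : coord (eps i) j = (i == j)%:R.
Proof.
rewrite (@coord_uniq _ [ffun k => (i == k)%:R]) ?ffunE //.
rewrite (bigD1 i) //= big1 ?ffunE ?eqxx ?addr0 // => k ki.
by rewrite ffunE eq_sym (negPf ki).
Qed.

Definition wt s : subgroup G := match s with inl a | inr a => a end.

(** With [g_coef], the bracket of two basis vectors of g(G, lam) as one scalar
times one basis vector; for two I's the scalar is 0 and the index is chosen so
that it remains additive in the degrees. *)
Definition g_idx s t : S :=
  match s, t with
  | inl a, inl b => inl (a + b)
  | _, _ => inr (wt s + wt t)
  end.

Definition g_coef s t : K :=
  match s, t with
  | inl a, inl b => emb b - emb a
  | inl a, inr b => emb b - lam * emb a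
  | inr a, inl b => - (emb a - lam * emb b)
  | inr _, inr _ => 0
  end.

Lemma g_lieU s t :
  [lie << s >> : gLie G lam, << t >>] = g_coef s t *: << g_idx s t >>.
Proof.
case: s t => [] a [] b; rewrite /lie /= malg_lieU //=.
- by rewrite scaleNr [a + b]addrC.
- by rewrite scale0r.
Qed.

Lemma wt_g_idx s t : wt (g_idx s t) = wt s + wt t.
Proof. by case: s t => [] a [] b. Qed.

Lemma g_idx_rot r s t : g_idx s (g_idx t r) = g_idx r (g_idx s t).
Proof.
by case: r s t => [] a [] b [] c /=; first [congr inl | congr inr];
  rewrite addrA [LHS]addrC.
Qed.

Lemma g_coef_jacobi r s t : g_coef s t * g_coef r (g_idx s t)
  + g_coef t r * g_coef s (g_idx t r) + g_coef r s * g_coef t (g_idx r s) = 0.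
Proof.
by case: r s t => [] a [] b [] c; rewrite /g_coef /g_idx /wt ?embD; ring.
Qed.

Lemma g_coef_anti s t : g_coef s t = - g_coef t s.
Proof. by case: s t => [] a [] b; rewrite /g_coef ?oppr0 ?opprK ?opprB. Qed.

Lemma g_idxC s t : g_idx s t = g_idx t s.
Proof. by case: s t => [] a [] b; rewrite /g_idx /wt [a + b]addrC. Qed.

Definition virasoro a : K := (emb a ^+ 3 - emb a) / 12.

(** The coefficient of C_LI^(i) in [L_a, I_{-a}]. An index i <> 0 is the successor
of an index j of the basis eps, and j = 0 stands for the Virasoro-type term. *)
Definition LI_cocycle (i : 'I_n.+1) a : K :=
  match unlift ord0 i with
  | None => (emb a ^+ 2 + emb a) * (lam == 0)%:R
  | Some j => if j == Ordinal hn then virasoro a * (lam == 1)%:R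
              else (coord a j)%:~R * (lam == - 2)%:R
  end.

Lemma LI_cocycleP i a b : (emb b - emb a) * LI_cocycle i (a + b) =
  (emb a + emb b + lam * emb a) * LI_cocycle i b
  - (emb a + emb b + lam * emb b) * LI_cocycle i a.
Proof.
rewrite /LI_cocycle /virasoro.
case: unliftP => [j _|_]; last first.
  case: eqP => [->|_]; last by rewrite !mulr0 subr0.
  by rewrite !embD; ring.
case: (j == _).
  case: eqP => [->|_]; last by rewrite !mulr0 subr0.
  by rewrite !embD; field.
case: eqP => [->|_]; last by rewrite !mulr0 subr0.
by rewrite coordD; ring.
Qed.

Definition zero_weight_cocycle c s t : K :=
  match c, s, t with
  | CL, inl a, inl _ => virasoro a
  | CI, inr a, inr _ => emb a * (lam == 0)%:R
  | CLI i, inl a, inr _ => LI_cocycle i a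
  | CLI i, inr _, inl b => - LI_cocycle i b
  | _, _, _ => 0
  end.

Definition g_cocycle c s t : K :=
  (wt s + wt t == 0)%:R * zero_weight_cocycle c s t.

Lemma g_cocycle_anti c s t : g_cocycle c s t = - g_cocycle c t s.
Proof.
rewrite /g_cocycle [wt t + _]addrC; case: eqP => [/eqP|_]; last first.
  by rewrite !mul0r oppr0.
rewrite !mul1r addrC addr_eq0 => /eqP.
case: s t => [] a [] b; rewrite /wt => ->; case: c => [||i];
  rewrite /zero_weight_cocycle ?oppr0 ?opprK // /virasoro !embN; ring.
Qed.

(** An omitted central symbol has a vanishing Kronecker delta. *)
Lemma g_cocycle_absent c s t : ~~ present lam c -> g_cocycle c s t = 0.
Proof.
rewrite /g_cocycle; case: c => [||i] //=.
  by move/negPf => lam0; case: s t => [] a [] b; rewrite ?lam0 ?mulr0.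
suff LI0 : ~~ present lam (CLI i) -> forall a, LI_cocycle i a = 0.
  by move=> /LI0 {}LI0; case: s t => [] a [] b; rewrite ?LI0 ?oppr0 mulr0.
move=> + a; rewrite /LI_cocycle /=; case: unliftP => [j ->|->] /=; last first.
  by move/negPf ->; rewrite mulr0.
rewrite /bump /= -(inj_eq val_inj) /=.
by case: (val j) => [|k] /= /negPf ->; rewrite mulr0.
Qed.

(** Each central symbol has a 2-cocycle as coefficient. The identity is invariant
under rotation of (r, s, t), so that for two L's and one I, and for one L and two
I's, a single order has to be computed. *)
Lemma g_cocycleP c r s t : g_coef s t * g_cocycle c r (g_idx s t)
  + g_coef t r * g_cocycle c s (g_idx t r) + g_coef r s * g_cocycle c t (g_idx r s)
  = 0.
Proof.
have e1 : wt r + (wt s + wt t) = wt r + wt s + wt t by rewrite addrA.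
have e2 : wt s + (wt t + wt r) = wt r + wt s + wt t by rewrite addrA addrC addrA.
have e3 : wt t + (wt r + wt s) = wt r + wt s + wt t by rewrite addrC.
rewrite /g_cocycle !wt_g_idx e1 e2 e3 {e1 e2 e3}.
have [|_] := eqVneq (wt r + wt s + wt t) 0; last by rewrite !mul0r !mulr0 !addr0.
rewrite addrC => /eqP; rewrite addr_eq0 !mul1r => /eqP.
pose P r s t := g_coef s t * zero_weight_cocycle c r (g_idx s t)
  + g_coef t r * zero_weight_cocycle c s (g_idx t r)
  + g_coef r s * zero_weight_cocycle c t (g_idx r s).
rewrite -/(P r s t) => wtE.
have rotP x y z : P y z x = 0 -> P x y z = 0.
  by move=> <-; rewrite /P -addrA addrC.
have LLI a b d : d = - (a + b) -> P (inl a) (inl b) (inr d) = 0.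
  rewrite /P => ->; case: (c) => [||i];
    rewrite /g_idx /g_coef /wt /zero_weight_cocycle; try ring.
  have := LI_cocycleP i a b; rewrite !embN !embD.
  set u := LI_cocycle _ _; set v := LI_cocycle _ _; set w := LI_cocycle _ _.
  rewrite mulrN => ->; ring.
have LII a b d : d = - (a + b) -> P (inl a) (inr b) (inr d) = 0.
  rewrite /P => ->; case: (c) => [||i];
    rewrite /g_idx /g_coef /wt /zero_weight_cocycle; try ring.
  rewrite !embN !embD; case: eqP => [->|_]; rewrite ?mulr0; ring.
case: r s t wtE => [] a [] b [] d; rewrite /wt => wtE.
- rewrite /P wtE; case: (c) => [||i];
    rewrite /g_idx /g_coef /wt /zero_weight_cocycle; try ring.
  by rewrite /virasoro ?embN ?embD; field.
- exact: LLI.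
- by do 2!apply: (rotP); apply: LLI; rewrite wtE opprD opprK addrC addKr.
- exact: LII.
- by apply: (rotP); apply: LLI; rewrite wtE opprD opprK addrC addrK.
- by apply: (rotP); apply: LII; rewrite wtE opprD opprK addrC addrK.
- by do 2!apply: (rotP); apply: LII; rewrite wtE opprD opprK addrC addKr.
- by rewrite /P; case: (c) => [||i];
    rewrite /g_idx /g_coef /wt /zero_weight_cocycle; ring.
Qed.

(** A pair whose bracket in g(G, lam) is a nonzero multiple of s, and on which all
the scalar cocycles vanish. *)
Definition root_pair s : S * S :=
  if wt s == 0
  then (inl (- one), match s with inl _ => inl one | inr _ => inr one end)
  else (inl 0, s).

(** A degree at which the i-th LI cocycle is nonzero, whereas all the others
present for the same lam vanish. *)
Definition witness_arg (i : 'I_n.+1) : subgroup G :=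
  match unlift ord0 i with
  | None => one
  | Some j => if j == Ordinal hn then one + one else eps j
  end.

(** Pairs dual to the scalar cocycles ([witness_neq0], [witness_eq0]): evaluation
on them recovers the coefficients of a combination of cocycles. *)
Definition witness c : S * S :=
  match c with
  | CL => (inl (one + one), inl (- (one + one)))
  | CI => (inr one, inr (- one))
  | CLI i => (inl (witness_arg i), inr (- witness_arg i))
  end.

Lemma root_pairP s : g_idx (root_pair s).1 (root_pair s).2 = s.
Proof.
rewrite /root_pair; case: eqP; last first.
  by case: s => a _; rewrite /fst /snd /g_idx /wt add0r.
by case: s => a; rewrite /wt => ->; rewrite /fst /snd /g_idx /wt addNr.
Qed.

Lemma root_pair_coef s : lam != -1 ->
  g_coef (root_pair s).1 (root_pair s).2 != 0.
Proof.
move=> lamN1; rewrite /root_pair; have [_|wt0] := eqVneq (wt s) 0.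
  case: s => a; rewrite /fst /snd /g_coef embN emb_one ?mulrN1 opprK addrC.
    by rewrite -mulr2n pnatr_eq0.
  by rewrite addr_eq0.
have := wt0; rewrite -(inj_eq emb_inj) emb0.
by case: s {wt0} => a; rewrite /fst /snd /g_coef /wt emb0 ?mulr0 subr0.
Qed.

Lemma virasoroN1 : virasoro (- one) = 0.
Proof. by rewrite /virasoro embN emb_one; field. Qed.

Lemma LI_cocycleN1 i : LI_cocycle i (- one) = 0.
Proof.
rewrite /LI_cocycle virasoroN1; case: unliftP => [j _|_]; last first.
  by rewrite embN emb_one sqrrN expr1n addrN mul0r.
case: eqP => [_|/eqP nj]; first by rewrite mul0r.
by rewrite coordN coord_eps eq_sym (negPf nj) oppr0 mul0r.
Qed.

Lemma root_pair_cocycle c s : g_cocycle c (root_pair s).1 (root_pair s).2 = 0.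
Proof.
rewrite /g_cocycle /root_pair; have [_|wt0] := eqVneq (wt s) 0; last first.
  by rewrite [wt _ + _]add0r (negPf wt0) mul0r.
by case: s => a; case: c => [||i]; rewrite /= ?virasoroN1 ?LI_cocycleN1 ?mulr0.
Qed.

Lemma virasoro2 : virasoro (one + one) = 2^-1.
Proof. by rewrite /virasoro embD emb_one; field. Qed.

Lemma g_cocycle_opp c s t : wt s + wt t = 0 ->
  g_cocycle c s t = zero_weight_cocycle c s t.
Proof. by rewrite /g_cocycle => ->; rewrite eqxx mul1r. Qed.

Lemma wt_witness c : wt (witness c).1 + wt (witness c).2 = 0.
Proof. by case: c => [||i]; rewrite /wt /= subrr. Qed.

Lemma present_LI i : present lam (CLI i) =
  match unlift ord0 i with
  | None => lam == 0
  | Some j => if j == Ordinal hn then lam == 1 else lam == - 2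
  end.
Proof.
rewrite /=; case: unliftP => [j ->|->] //; rewrite /= /bump /= -(inj_eq val_inj) /=.
by case: (val j).
Qed.

Lemma witness_neq0 c :
  present lam c -> g_cocycle c (witness c).1 (witness c).2 != 0.
Proof.
rewrite g_cocycle_opp ?wt_witness //.
case: c => [_|lam0|i]; rewrite /witness /fst /snd /zero_weight_cocycle.
- by rewrite virasoro2 invr_eq0 pnatr_eq0.
- by rewrite emb_one [lam == 0]lam0 mulr1 oner_eq0.
rewrite present_LI /LI_cocycle /witness_arg.
case: (unlift ord0 i) => [j|]; last first.
  by move=> ->; rewrite emb_one expr1n mulr1 -mulr2n pnatr_eq0.
case: (j == _) => ->; first by rewrite virasoro2 mulr1 invr_eq0 pnatr_eq0.
by rewrite coord_eps eqxx mulr1 oner_eq0.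
Qed.

Lemma witness_eq0 c c' : present lam c -> c' != c ->
  g_cocycle c' (witness c).1 (witness c).2 = 0.
Proof.
move=> pc cc'; rewrite g_cocycle_opp ?wt_witness //.
case: c c' pc cc' => [||i] [||i'] //; rewrite present_LI.
rewrite /witness /fst /snd /zero_weight_cocycle /LI_cocycle /witness_arg => pi ii'.
have {ii'} : unlift ord0 i' != unlift ord0 i.
  apply: contraNN ii' => /eqP eq_u; apply/eqP; congr CLI.
  by case: (unliftP ord0 i) eq_u => [j|] ->;
    case: (unliftP ord0 i') => [j'|] -> // [->].
case: (unlift ord0 i') (unlift ord0 i) pi => [j'|] [j|] //.
- have [->|nj] := eqVneq j (Ordinal hn); have [->|nj'] := eqVneq j' (Ordinal hn).
  + by rewrite eqxx.
  + by move=> /eqP -> _; rewrite -subr_eq0 opprK -(natrD _ 1 2) pnatr_eq0 mulr0.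
  + move=> /eqP -> _; rewrite eq_sym -subr_eq0 opprK -(natrD _ 1 2).
    by rewrite pnatr_eq0 mulr0.
  + move=> _; rewrite coord_eps eq_sym => /negPf jj'.
    by rewrite (_ : (j == j') = false) ?mul0r //; apply: contraFF jj' => /eqP ->.
- move=> /eqP -> _; case: (j' == _).
    by rewrite eq_sym oner_eq0 mulr0.
  by rewrite eq_sym oppr_eq0 pnatr_eq0 mulr0.
- case: (j == _) => /eqP -> _.
    by rewrite oner_eq0 mulr0.
  by rewrite oppr_eq0 pnatr_eq0 mulr0.
Qed.

(** * Classification of the normalised cocycles *)

Section Classification.
Variables (V : lmodType K) (D : S -> S -> V).
Hypothesis lamN1 : lam != -1.
Hypothesis D_anti : forall s t, D s t = - D t s.
Hypothesis D_jacobi : forall r s t, g_coef s t *: D r (g_idx s t)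
  + g_coef t r *: D s (g_idx t r) + g_coef r s *: D t (g_idx r s) = 0.
Hypothesis D_root : forall s, D (root_pair s).1 (root_pair s).2 = 0.

(** Jacobi identity with L_0: the degrees of s and t being a and b, it gives
(a + b) D(s, t) = 0 since D(L_0, -) vanishes in degree a + b <> 0. *)
Lemma normalised_weight_neq0 s t : wt s + wt t != 0 -> D s t = 0.
Proof.
move=> wt0; have := D_jacobi (inl 0) s t.
have := D_root (g_idx s t); rewrite /root_pair wt_g_idx (negPf wt0) => ->.
have -> : g_idx t (inl 0) = t by case: (t) => a; rewrite /g_idx /wt addr0.
have -> : g_idx (inl 0) s = s by case: (s) => a; rewrite /g_idx /wt add0r.
have -> : g_coef t (inl 0) = - emb (wt t).
  by case: (t) => a; rewrite /g_coef /wt emb0 ?mulr0 ?subr0 ?sub0r.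
have -> : g_coef (inl 0) s = emb (wt s).
  by case: (s) => a; rewrite /g_coef /wt emb0 ?mulr0 ?subr0 ?sub0r.
rewrite scaler0 add0r (D_anti t) scalerN -scalerBl -opprD -embD => /eqP.
by rewrite scaler_eq0 oppr_eq0 -emb0 (inj_eq emb_inj) addrC (negPf wt0) => /eqP.
Qed.

(** Here h is one of the families a |-> L_a (with mu = 1) and a |-> I_a (with
mu = lam). *)
Lemma normalised_equation (h : subgroup G -> S) (mu : K) :
  (forall a b, g_coef (inl a) (h b) = emb b - mu * emb a) ->
  (forall a b, g_idx (inl a) (h b) = h (a + b)) ->
  cocycle_equation emb mu (fun a => D (inl a) (h (- a))).
Proof.
move=> coefE idxE a b; have := D_jacobi (inl a) (inl b) (h (- (a + b))).
rewrite (g_coef_anti (h _)) (g_idxC (h _)) !coefE !idxE (D_anti (h _)).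
rewrite [g_coef _ _]/g_coef [g_idx _ _]/g_idx scalerN => /eqP.
rewrite subr_eq0 => /eqP <-.
have -> : b - (a + b) = - a by rewrite opprD addrC subrK.
have -> : a - (a + b) = - b by rewrite opprD addrA subrr add0r.
by rewrite addrC -[in RHS]scaleNr embN embD; congr (_ *: _ + _ *: _); ring.
Qed.

Lemma normalised_LL a : D (inl a) (inl (- a)) =
  ((emb a ^+ 3 - emb a) / 6) *: D (inl (one + one)) (inl (- (one + one))).
Proof.
have fE : cocycle_equation emb 1 (fun a => D (inl a) (inl (- a))).
  by apply: (normalised_equation (h := inl)) => // b c; rewrite mul1r.
have fN1 : D (inl (- one)) (inl (- - one)) = 0.
  by have := D_root (inl 0); rewrite /root_pair eqxx opprK.
exact: (equation_mu1 emb_one fE fN1 a erefl).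
Qed.

(** Jacobi identity of L_{-a}, I_a, I_0, which reads lam a D(I_a, I_{-a}) = 0. *)
Lemma normalised_II_eq0 : lam != 0 -> forall a, D (inr a) (inr (- a)) = 0.
Proof.
move=> lam0 a; have := D_jacobi (inl (- a)) (inr a) (inr 0).
have D00 : D (inr 0) (inr 0) = 0.
  have /eqP := D_anti (inr 0) (inr 0); rewrite -addr_eq0 -mulr2n -scaler_nat.
  by rewrite scaler_eq0 pnatr_eq0 => /eqP.
rewrite /g_coef /g_idx /wt !scale0r !add0r addNr D00 scaler0 addr0.
have [-> _|a0] := eqVneq a 0; first by rewrite oppr0.
rewrite embN mulrN opprK scaleNr => /eqP; rewrite oppr_eq0 scaler_eq0.
by rewrite mulf_eq0 (negPf lam0) -emb0 (inj_eq emb_inj) (negPf a0) => /eqP.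
Qed.

(** Jacobi identity of L_{-a-1}, I_a, I_1. *)
Lemma normalised_II a : lam = 0 ->
  D (inr a) (inr (- a)) = emb a *: D (inr one) (inr (- one)).
Proof.
move=> lam0; have := D_jacobi (inl (- (a + one))) (inr a) (inr one).
rewrite /g_coef /g_idx /wt lam0 !mul0r !subr0 scale0r add0r emb_one.
have -> : one - (a + one) = - a by rewrite opprD addrC subrK.
have -> : - (a + one) + a = - one by rewrite addrC opprD addrA subrr add0r.
by rewrite scaleN1r addrC => /eqP; rewrite subr_eq0 => /eqP.
Qed.

(** The quotients are 0 for the absent symbols, as inversion maps 0 to 0, so that
the four cases lam = 0, 1, -2 and generic fit in one formula. *)
Lemma normalised_LI a : D (inl a) (inr (- a)) =
  \sum_(i < n.+1) (LI_cocycle i a / LI_cocycle i (witness_arg i))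
     *: D (inl (witness_arg i)) (inr (- witness_arg i)).
Proof.
have fE : cocycle_equation emb lam (fun a => D (inl a) (inr (- a))).
  exact: (normalised_equation (h := inr)).
have fN1 : D (inl (- one)) (inr (- - one)) = 0.
  by have := D_root (inr 0); rewrite /root_pair eqxx opprK.
move: fE fN1; set f := (fun a => D (inl a) (inr (- a))).
rewrite -![D (inl _) (inr (- _))]/(f _) => fE fN1.
under eq_bigr => i _ do rewrite -![D (inl _) (inr (- _))]/(f _).
rewrite big_ord_recl (bigD1 (Ordinal hn)) //=.
rewrite /LI_cocycle /witness_arg unlift_none.
under [X in _ + (_ + X)]eq_bigr => i ni do rewrite liftK (negPf ni).
rewrite liftK eqxx virasoro2 emb_one expr1n.
have [lam0|lam0] := eqVneq lam 0.
  rewrite lam0 eq_sym oner_eq0 eq_sym oppr_eq0 pnatr_eq0 !mulr1 mulr0 mul0r.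
  rewrite scale0r add0r big1 ?addr0 => [|i _]; last by rewrite mulr0 mul0r scale0r.
  exact: (equation_mu0 emb_one fE fN1 a lam0).
rewrite !mulr0 mul0r scale0r add0r.
have [lam1|lam1] := eqVneq lam 1.
  rewrite lam1 (_ : (1 == -2) = false) ?mulr1; last first.
    by rewrite -subr_eq0 opprK -(natrD _ 1 2) pnatr_eq0.
  rewrite big1 ?addr0 => [|i _]; last by rewrite mulr0 mul0r scale0r.
  rewrite (equation_mu1 emb_one fE fN1 a lam1) /virasoro.
  by congr (_ *: _); field.
rewrite !mulr0 mul0r scale0r add0r.
have [lam2|lam2] := eqVneq lam (- 2); last first.
  rewrite (equation_generic emb_one fE fN1) // big1 // => i _.
  by rewrite mulr0 mul0r scale0r.
have f0 : f 0 = 0 by exact: (equation_at0 emb_one fE).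
have fD : {morph f : a b / a + b} by exact: (equation_additive emb_inj emb_one fE).
pose fA : {additive subgroup G -> V} :=
  HB.pack f (GRing.isNmodMorphism.Build _ _ f (f0, fD)).
have f1 : f one = 0 by apply: oppr_inj; rewrite oppr0 -(raddfN fA).
rewrite {1}(coordP a) (bigD1 (Ordinal hn)) //= fD.
rewrite [f (one *~ _)](raddfMz fA) [fA one]f1 mul0rz add0r.
rewrite [LHS](raddf_sum fA); apply: eq_bigr => i _.
by rewrite (raddfMz fA) coord_eps eqxx !mulr1 divr1 scaler_int.
Qed.

(** The main step: the scalar cocycles span all normalised cocycles, with
coefficients read off from the witnesses. *)
Lemma normalised_cocycle_expand s t : D s t = \sum_(c <- central_enum n)
  (g_cocycle c s t / g_cocycle c (witness c).1 (witness c).2)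
    *: D (witness c).1 (witness c).2.
Proof.
have [wt0|wtN0] := eqVneq (wt s + wt t) 0; last first.
  rewrite normalised_weight_neq0 // big1 // => c _.
  by rewrite /g_cocycle (negPf wtN0) !mul0r scale0r.
under eq_bigr => c _ do rewrite !g_cocycle_opp ?wt_witness //.
have wtE : wt t = - wt s by apply/eqP; rewrite -addr_eq0 addrC wt0.
rewrite big_central; case: s t wtE {wt0} => [] a [] b; rewrite /wt => ->;
  rewrite /zero_weight_cocycle /witness /fst /snd !mul0r !scale0r ?add0r.
- rewrite big1 ?addr0 => [|i _]; last by rewrite mul0r scale0r.
  rewrite virasoro2 /virasoro [LHS]normalised_LL.
  by congr (_ *: _); field.
- exact: normalised_LI.
- rewrite [LHS]D_anti; have := normalised_LI (- a); rewrite opprK => ->.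
  rewrite -sumrN; apply: eq_bigr => i _.
  by rewrite mulNr scaleNr.
- rewrite big1 ?addr0 => [|i _]; last by rewrite mul0r scale0r.
  have [lam0|lam0] := eqVneq lam 0; last first.
    by rewrite mulr0 mul0r scale0r normalised_II_eq0.
  by rewrite emb_one !mulr1 divr1 [LHS]normalised_II.
Qed.

End Classification.

(** * Lifts to a central extension, and the explicit cover *)

Hypothesis lamN1 : lam != -1.

(** The brackets of the theorem, for families indexed by all the basis vectors of
g(G, lam) at once. *)
Definition realizes (F : lieAlgType K) (M : S -> F) (C : central n -> F) :=
  (forall s t, [lie M s, M t] = g_coef s t *: M (g_idx s t)
     + \sum_(c <- central_enum n) g_cocycle c s t *: C c)
  /\ forall c, lie_central (C c).

(** The lift of s is the bracket of arbitrary lifts of its root pair; the defect D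
of these lifts is then a normalised cocycle. *)
Lemma central_extension_realizes (F : lieAlgType K) (q : {linear F -> gLie G lam}) :
  central_extension q -> exists (M : S -> F) (C : central n -> F),
  [/\ realizes M C, forall s, q (M s) = << s >> & forall c, q (C c) = 0].
Proof.
move=> q_ext; have [qM q_surj q_ker] := q_ext.
have [l ql] : exists l : S -> F, forall s, q (l s) = << s >>.
  have ex_lift s : exists x, q x == << s >>.
    by have [x xs] := q_surj << s >>; exists x; apply/eqP.
  by exists (fun s => xchoose (ex_lift s)) => s; apply/eqP/(xchooseP (ex_lift s)).
have [M ME] : exists M : S -> F, forall s,
    M s = (g_coef (root_pair s).1 (root_pair s).2)^-1
      *: [lie l (root_pair s).1, l (root_pair s).2] by eexists.
have q_M s : q (M s) = << s >>.
  rewrite ME (linearZZ q) qM (ql (root_pair s).1) (ql (root_pair s).2) g_lieU.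
  by rewrite scalerA mulVf ?root_pair_coef // scale1r root_pairP.
have q_MM s t : q [lie M s, M t] = g_coef s t *: << g_idx s t >>.
  by rewrite qM (q_M s) (q_M t) g_lieU.
pose D s t := [lie M s, M t] - g_coef s t *: M (g_idx s t).
have q_D s t : q (D s t) = 0.
  by rewrite (linearB q) (linearZZ q) q_MM (q_M (g_idx s t)) subrr.
have D_anti s t : D s t = - D t s.
  rewrite /D opprB lieC g_coef_anti g_idxC scaleNr opprK addrC.
  by rewrite (g_coef_anti t).
have D_jacobi r s t : g_coef s t *: D r (g_idx s t)
  + g_coef t r *: D s (g_idx t r) + g_coef r s *: D t (g_idx r s) = 0.
  have e x y z : g_coef y z *: D x (g_idx y z) = [lie M x, [lie M y, M z]]
      - (g_coef y z * g_coef x (g_idx y z)) *: M (g_idx x (g_idx y z)).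
    rewrite scalerBr scalerA -lieZr; congr (_ - _).
    apply: (ext_lie_congr q_ext).
    by rewrite (linearZZ q) q_MM (q_M (g_idx y z)).
  rewrite (e r s t) (e s t r) (e t r s) (g_idx_rot s t r) (g_idx_rot r s t).
  rewrite [X in X + _]addrACA [LHS]addrACA lie_jacobi add0r -!opprD -!scalerDl.
  by rewrite g_coef_jacobi scale0r oppr0.
have D_root s : D (root_pair s).1 (root_pair s).2 = 0.
  rewrite /D root_pairP [X in _ *: X]ME scalerA divff ?root_pair_coef // scale1r.
  rewrite (ext_lie_congl q_ext _ (x' := l (root_pair s).1)) ?ql ?q_M //.
  by rewrite (ext_lie_congr q_ext _ (y' := l (root_pair s).2)) ?ql ?q_M // subrr.
exists M, (fun c => (g_cocycle c (witness c).1 (witness c).2)^-1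
             *: D (witness c).1 (witness c).2).
have q_C c : q ((g_cocycle c (witness c).1 (witness c).2)^-1
             *: D (witness c).1 (witness c).2) = 0.
  by rewrite (linearZZ q) q_D scaler0.
split=> //; split=> [s t|c]; last exact: q_ker.
rewrite -[LHS](subrK (g_coef s t *: M (g_idx s t))) addrC; congr (_ + _).
rewrite [LHS](normalised_cocycle_expand lamN1 D_anti D_jacobi D_root).
by apply: eq_bigr => c _; rewrite scalerA.
Qed.

Local Notation T := (S + {c : central n | present lam c})%type.
Local Notation bT := {malg K[T]}.

Definition cover_basis s : bT := << inl s >>.

(** The value 0 at the omitted symbols lets the central part of a bracket be a sum
over all the symbols. *)
Definition cover_central c : bT :=
  oapp (fun c' : {c : central n | present lam c} => << inr c' >>) 0 (insub c).

Definition cover_br (x y : T) : bT :=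
  match x, y with
  | inl s, inl t => g_coef s t *: cover_basis (g_idx s t)
      + \sum_(c <- central_enum n) g_cocycle c s t *: cover_central c
  | _, _ => 0
  end.

Lemma cover_br_anti x y : cover_br x y + cover_br y x = 0.
Proof.
case: x y => [s|c] [t|c']; rewrite /cover_br ?addr0 //.
rewrite addrACA (g_coef_anti s) g_idxC scaleNr addNr add0r -big_split big1 // => c _.
by rewrite /= g_cocycle_anti scaleNr addNr.
Qed.

Lemma cover_lie_inr (k : {c : central n | present lam c}) x :
  malg_lie cover_br << inr k >> x = 0.
Proof. by rewrite /malg_lie mcombU /mcomb big1 // => t _; rewrite scaler0. Qed.

Lemma cover_lie_centrall c x : malg_lie cover_br (cover_central c) x = 0.
Proof.
rewrite /cover_central; case: insub => [c'|]; first exact: cover_lie_inr.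
exact: (linear0 (mcomb _)).
Qed.

Lemma cover_lie_centralr x c : malg_lie cover_br x (cover_central c) = 0.
Proof.
by have := malg_lie_anti cover_br_anti x (cover_central c);
  rewrite cover_lie_centrall addr0.
Qed.

Lemma cover_br_jacobi x y z : malg_lie cover_br << x >> (cover_br y z)
  + malg_lie cover_br << y >> (cover_br z x)
  + malg_lie cover_br << z >> (cover_br x y) = 0.
Proof.
have br_l k u : cover_br (inr k) u = 0 by [].
have br_r k u : cover_br u (inr k) = 0 by case: u.
have add3 (u v w : bT) : u = 0 -> v = 0 -> w = 0 -> u + v + w = 0.
  by move=> -> -> ->; rewrite !addr0.
case: x => [r|k]; last first.
  apply: add3; first exact: cover_lie_inr.
    by rewrite br_r malg_lie0r.
  by rewrite br_l malg_lie0r.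
case: y => [s|k]; last first.
  apply: add3; [by rewrite br_l malg_lie0r | exact: cover_lie_inr |].
  by rewrite br_r malg_lie0r.
case: z => [t|k]; last first.
  apply: add3; [by rewrite br_r malg_lie0r | | exact: cover_lie_inr].
  by rewrite br_l malg_lie0r.
have e x y z : malg_lie cover_br << inl x >> (cover_br (inl y) (inl z))
  = (g_coef y z * g_coef x (g_idx y z)) *: cover_basis (g_idx x (g_idx y z))
    + \sum_(c <- central_enum n) (g_coef y z * g_cocycle c x (g_idx y z))
        *: cover_central c.
  apply: (etrans (linear_extension_term
    (malg_lie cover_br << inl x >>) _ _ _ _ _)) => /=.
  rewrite [X in _ + X]big1 => [|c _]; last first.
    by rewrite (_ : malg_lie _ _ _ = 0) ?scaler0 //; exact: cover_lie_centralr.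
  rewrite addr0 (_ : malg_lie _ _ _ = cover_br (inl x) (inl (g_idx y z))); last first.
    exact: malg_lieU.
  rewrite /cover_br scalerDr scalerA scaler_sumr; congr (_ + _).
  by apply: eq_bigr => c _; rewrite scalerA.
apply: (etrans (congr2 +%R (congr2 +%R (e r s t) (e s t r)) (e t r s))).
rewrite (g_idx_rot s t r) (g_idx_rot r s t).
rewrite [X in X + _]addrACA [LHS]addrACA -!scalerDl g_coef_jacobi scale0r add0r.
rewrite -!big_split big1 // => c _.
by rewrite /= -!scalerDl g_cocycleP scale0r.
Qed.

Definition cover : lieAlgType K := HB.pack_for (lieAlgType K) bT
  (isLieAlgebra.Build K bT (malg_lie_linearl cover_br) (malg_lie_linearr cover_br)
    (malg_liexx cover_br_anti) (malg_lie_jacobi cover_br_jacobi)).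

Lemma cover_lieE (x y : cover) : [lie x, y] = malg_lie cover_br x y.
Proof. by []. Qed.

Lemma cover_realizes : @realizes cover cover_basis cover_central.
Proof.
split=> [s t|c x]; rewrite cover_lieE; first by rewrite malg_lieU.
exact: cover_lie_centrall.
Qed.

(** Families obeying the brackets of the theorem induce morphisms from [cover]. *)
Section CoverMap.
Variables (F : lieAlgType K) (M : S -> F) (C : central n -> F).

Definition cover_map : cover -> F :=
  mcomb (gbar_family (lam := lam) (fun a => M (inl a)) (fun a => M (inr a)) C).

Lemma cover_map_linear : linear cover_map.
Proof. exact: mcomb_linear. Qed.

HB.instance Definition _ :=
  GRing.isLinear.Build K cover F *:%R cover_map cover_map_linear.

Lemma cover_map_basis s : cover_map (cover_basis s) = M s.
Proof. by rewrite [LHS]mcombU; case: s. Qed.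

Lemma cover_map_central c :
  present lam c -> cover_map (cover_central c) = C c.
Proof.
by move=> pc; rewrite /cover_central insubT [LHS]mcombU.
Qed.

Lemma cover_map_morphism : realizes M C -> lie_morphism cover_map.
Proof.
move=> [MM C0] x y.
move: x; apply: malg_linear_eq => [c u v|c u v|s].
- exact: (etrans (congr1 _ (lie_linearl (y : cover) c u v)) (cover_map_linear c _ _)).
- exact: (etrans (congr1 (lie^~ _) (cover_map_linear c u v)) (lie_linearl _ c _ _)).
move: y; apply: malg_linear_eq => [c u v|c u v|t].
- exact: (etrans (congr1 _ (lie_linearr (<< s >> : cover) c u v)) (cover_map_linear c _ _)).
- exact: (etrans (congr1 (lie _) (cover_map_linear c u v)) (lie_linearr _ c _ _)).
have -> : [lie (<< s >> : cover), << t >>] = cover_br s t by exact: malg_lieU.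
have mapU u : cover_map << u >> =
    gbar_family (fun a => M (inl a)) (fun a => M (inr a)) C u.
  exact: mcombU.
apply: (etrans _ (esym (congr2 lie (mapU s) (mapU t)))).
case: s => [s|k]; last first.
  by rewrite [RHS]C0; exact: (linear0 cover_map).
case: t => [t|k]; last first.
  by rewrite [RHS](central_lier _ (C0 _)); exact: (linear0 cover_map).
transitivity [lie M s, M t]; last by case: s t => [] a [] b.
rewrite MM; apply: (etrans (linear_extension_term cover_map _ _ _ _ _)).
congr (_ + _); first by congr (_ *: _); exact: cover_map_basis.
apply: eq_bigr => c _ /=; have [pc|npc] := boolP (present lam c).
  by rewrite cover_map_central.
by rewrite g_cocycle_absent // !scale0r.
Qed.

End CoverMap.

(** The basis of g(G, lam) itself obeys these brackets, with all the central
elements equal to 0. *)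
Definition cover_proj : {linear cover -> gLie G lam} :=
  cover_map (fun s => << s >> : gLie G lam) (fun _ => 0).

(** * Universality *)

Lemma cover_linear_eq (V : lmodType K) (f g : {linear cover -> V}) :
  (forall s, f (cover_basis s) = g (cover_basis s)) ->
  (forall c, present lam c -> f (cover_central c) = g (cover_central c)) ->
  f =1 g.
Proof.
move=> fgM fgC; apply: malg_linear_eq => [||[s|k]]; [exact: linearP.. | exact: fgM |].
have := fgC _ (valP k); by rewrite /cover_central valK.
Qed.

Lemma cover_proj_basis s : cover_proj (cover_basis s) = << s >>.
Proof. exact: cover_map_basis. Qed.

Lemma cover_proj_central c : cover_proj (cover_central c) = 0.
Proof.
have [pc|npc] := boolP (present lam c).
  exact: (cover_map_central (F := gLie G lam) _ (fun _ => 0)).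
rewrite (_ : cover_central c = 0) ?linear0 //.
by rewrite /cover_central insubF // (negPf npc).
Qed.

Lemma cover_proj_extension : central_extension cover_proj.
Proof.
split.
- apply: cover_map_morphism; split=> [s t|c x]; last exact: lie0l.
  by rewrite g_lieU big1 ?addr0 // => c _; rewrite scaler0.
- move=> y; exists (mcomb cover_basis y).
  move: y; apply: malg_linear_eq => [c u v|//|s].
    by rewrite mcomb_linear; exact: linearP.
  by rewrite mcombU cover_proj_basis.
move=> z pz0 y.
(* Replacing z by the lift of its image changes z by a combination of central
   basis vectors only, which does not affect [z, y]. *)
pose lift : {linear gLie G lam -> cover} :=
  HB.pack (mcomb cover_basis : gLie G lam -> cover)
    (GRing.isLinear.Build K (gLie G lam) cover *:%R
      (mcomb cover_basis) (mcomb_linear _)).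
have lift_basis s : lift << s >> = cover_basis s by exact: mcombU.
pose adr : {linear cover -> cover} :=
  HB.pack (fun x : cover => [lie x, y])
    (GRing.isLinear.Build K cover cover *:%R _ (lie_linearl y)).
suff adr_lift : adr =1 (adr \o (lift \o cover_proj)).
  transitivity (adr (lift (cover_proj z))); first exact: adr_lift.
  by rewrite pz0 (linear0 lift) (linear0 adr).
apply: cover_linear_eq => [s|c pc].
  transitivity (adr (lift (cover_proj (cover_basis s)))); last by [].
  by rewrite cover_proj_basis lift_basis.
transitivity (adr (lift (cover_proj (cover_central c)))); last by [].
rewrite cover_proj_central (linear0 lift) (linear0 adr).
exact: cover_lie_centrall.
Qed.

(** Existence comes from the lifts in F. For uniqueness, two morphisms over
g(G, lam) agree on brackets; brackets of root pairs give the lifted basis, and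
then brackets of witnesses give the central basis vectors one by one. *)
Lemma cover_universal : universal_central_extension cover_proj.
Proof.
split=> [|F q q_ext]; first exact: cover_proj_extension.
have [M [C [MC qM qC]]] := central_extension_realizes q_ext.
pose f : {linear cover -> F} := cover_map M C.
have fM : lie_morphism f by exact: cover_map_morphism.
have f_basis s : f (cover_basis s) = M s by exact: cover_map_basis.
have f_central c : present lam c -> f (cover_central c) = C c.
  exact: cover_map_central.
have qf x : q (f x) = cover_proj x.
  move: x; apply: (cover_linear_eq (f := q \o f)) => [s|c pc].
    rewrite [LHS](_ : _ = q (f (cover_basis s))) //.
    by rewrite f_basis qM cover_proj_basis.
  rewrite [LHS](_ : _ = q (f (cover_central c))) //.
  by rewrite f_central // qC cover_proj_central.
exists f; split=> // f' f'M qf'.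
have agree (x y : cover) : f' [lie x, y] = f [lie x, y].
  by apply: (ext_morphism_lie_eq q_ext) => // z; rewrite qf' -qf.
have [cover_lie _] := cover_realizes.
have agree_basis s : f' (cover_basis s) = f (cover_basis s).
  have := agree (cover_basis (root_pair s).1) (cover_basis (root_pair s).2).
  rewrite cover_lie root_pairP big1 => [|c _]; last first.
    by rewrite root_pair_cocycle scale0r.
  rewrite addr0 (linearZZ f') (linearZZ f).
  exact/scalerI/root_pair_coef.
apply: cover_linear_eq => [|c pc]; first exact: agree_basis.
have := agree (cover_basis (witness c).1) (cover_basis (witness c).2).
rewrite cover_lie (bigD1_seq c) ?mem_central_enum ?central_enum_uniq //=.
rewrite big1 => [|c' cc']; last by rewrite witness_eq0 // scale0r.
rewrite addr0 (linearD f') (linearD f) !(linearZZ f') !(linearZZ f).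
rewrite agree_basis => /addrI; exact/scalerI/witness_neq0.
Qed.

Lemma realizes_comp (E F : lieAlgType K) (f : {linear E -> F})
    (M : S -> E) (C : central n -> E) :
  lie_morphism f -> realizes M C -> (forall c, lie_central (f (C c))) ->
  realizes (f \o M) (f \o C).
Proof.
move=> fM [MM _] fC; split=> // s t.
by rewrite /= -fM MM linear_extension_term.
Qed.

Lemma universal_central_extension_presentation (E : lieAlgType K)
    (p : {linear E -> gLie G lam}) : universal_central_extension p ->
  exists (M : S -> E) (C : central n -> E),
  [/\ is_basis (gbar_family (lam := lam) (fun a => M (inl a))
        (fun a => M (inr a)) C),
      realizes M C, forall s, p (M s) = << s >> & forall c, p (C c) = 0].
Proof.
move=> p_univ.
have [f [f' [fM pf fK f'K]]] :=
  universal_central_extension_iso cover_universal p_univ.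
have [[_ _ p_ker] _] := p_univ.
have pfC c : p (f (cover_central c)) = 0 by rewrite pf cover_proj_central.
exists (f \o cover_basis), (f \o cover_central); split=> [x|||//].
- have famE m : mcomb (gbar_family (lam := lam)
      (fun a => (f \o cover_basis) (inl a))
      (fun a => (f \o cover_basis) (inr a)) (f \o cover_central)) m = f m.
    move: m; apply: (cover_linear_eq (f := mcomb _)) => [s|c pc].
      by rewrite [LHS]mcombU; case: s.
    by rewrite [in LHS]/cover_central insubT [LHS]mcombU.
  exists (f' x); split; first by rewrite famE f'K.
  by move=> m; rewrite famE => ->; rewrite fK.
- apply: realizes_comp => // [|c]; first exact: cover_realizes.
  exact: p_ker.
- by move=> s; rewrite /= pf cover_proj_basis.
Qed.

(** The next lemmas split the sum over the central symbols into the terms of the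
three displayed brackets. *)
Section Brackets.
Variables (E : lieAlgType K) (M : S -> E) (C : central n -> E).
Hypothesis MC : realizes M C.

Lemma realizes_LL a b : [lie M (inl a), M (inl b)] =
  (val b - val a) *: M (inl (a + b))
  + ((val a ^+ 3 - val a) / 12 * (a + b == 0)%:R) *: C CL.
Proof.
rewrite MC.1 big_central /g_cocycle /zero_weight_cocycle /wt.
rewrite [X in _ + (_ + (_ + X))]big1 => [|i _]; last by rewrite mulr0 scale0r.
by rewrite mulr0 scale0r !addr0 [_%:R * _]mulrC.
Qed.

Lemma realizes_II a b : [lie M (inr a), M (inr b)] =
  (val a * (a + b == 0)%:R * (lam == 0)%:R) *: C CI.
Proof.
rewrite MC.1 big_central /g_cocycle /zero_weight_cocycle /wt.
rewrite [X in _ + (_ + (_ + X))]big1 => [|i _]; last by rewrite mulr0 scale0r.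
by rewrite mulr0 !scale0r !add0r addr0 mulrCA mulrA.
Qed.

Lemma realizes_LI a b (m : {ffun 'I_n -> int}) :
  a = \sum_(i < n) eps i *~ m i ->
  [lie M (inl a), M (inr b)] =
  (val b - lam * val a) *: M (inr (a + b))
  + (a + b == 0)%:R *:
    ((((val a) ^+ 2 + val a) * (lam == 0)%:R) *: C (CLI (inord 0))
     + ((val a ^+ 3 - val a) / 12 * (lam == 1)%:R) *: C (CLI (inord 1))
     + \sum_(i < n | (0 < i)%N)
         ((m i)%:~R * (lam == - 2)%:R) *: C (CLI (inord i.+1))).
Proof.
move=> /coord_uniq am; have lift_inord (i : 'I_n) : inord i.+1 = lift ord0 i.
  by apply: val_inj; rewrite /= inordK ?ltnS.
have inord0 : inord 0 = ord0 :> 'I_n.+1 by apply: val_inj; rewrite /= inordK.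
rewrite MC.1 big_central /g_cocycle /zero_weight_cocycle [wt _ + wt _]/(a + b).
rewrite !mulr0 !scale0r !add0r; congr (_ + _).
under eq_bigr => i _ do rewrite -scalerA.
rewrite -scaler_sumr big_ord_recl (bigD1 (Ordinal hn)) //= addrA inord0.
rewrite /LI_cocycle unlift_none liftK eqxx -(lift_inord (Ordinal hn)).
congr (_ *: (_ + _)); apply: eq_big => [i|i ni].
  by rewrite -(inj_eq val_inj) /= lt0n.
by rewrite liftK (negPf ni) am lift_inord.
Qed.

End Brackets.
End Cocycles.

Theorem theorem2p4 (R : realType) (G : zmodClosed R[i])
    (n : nat) (hn : (0 < n)%N)
    (eps : 'I_n -> subgroup G) (eps_basis : is_Zbasis eps)
    (eps1 : val (eps (Ordinal hn)) = 1)
    (hG : forall k : nat, (1 < k)%N -> (k%:R)^-1 \notin G)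
    (lam : R[i]) (hlam : lam != -1) :
  (exists (E : lieAlgType R[i]) (p : {linear E -> gLie G lam}),
     universal_central_extension p)
  /\
  forall (E : lieAlgType R[i]) (p : {linear E -> gLie G lam}),
    universal_central_extension p ->
    exists (L I : subgroup G -> E) (C : central n -> E),
      is_basis (gbar_family (lam := lam) L I C)
      /\ (forall c : central n, lie_central (C c))
      /\ (forall a : subgroup G, p (L a) = gL lam a)
      /\ (forall a : subgroup G, p (I a) = gI lam a)
      /\ (forall c : central n, p (C c) = 0)
      /\ (forall a b : subgroup G,
            [lie L a, L b] =
              (val b - val a) *: L (a + b)
              + ((val a ^+ 3 - val a) / 12 * (a + b == 0)%:R) *: C CL)
      /\ (forall a b : subgroup G,
            [lie I a, I b] =
              (val a * (a + b == 0)%:R * (lam == 0)%:R) *: C CI)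
      /\ (forall (a b : subgroup G) (m : {ffun 'I_n -> int}),
            a = \sum_(i < n) eps i *~ m i ->
            [lie L a, I b] =
              (val b - lam * val a) *: I (a + b)
              + (a + b == 0)%:R *:
                ((((val a) ^+ 2 + val a) * (lam == 0)%:R) *: C (CLI (inord 0))
                 + ((val a ^+ 3 - val a) / 12 * (lam == 1)%:R)
                     *: C (CLI (inord 1))
                 + \sum_(i < n | (0 < i)%N)
                     ((m i)%:~R * (lam == - 2)%:R) *: C (CLI (inord i.+1)))).
Proof.
split=> [|E p p_univ].
  exists (cover hn eps_basis lam), (cover_proj hn eps_basis lam).
  exact: cover_universal.
have [M [C [MC_basis MC pM pC]]] :=
  universal_central_extension_presentation eps_basis eps1 hlam p_univ.
exists (fun a => M (inl a)), (fun a => M (inr a)), C.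
split; first exact: MC_basis.
split; first exact: MC.2.
split=> [a|]; first exact: pM.
split=> [a|]; first exact: pM.
split; first exact: pC.
split; first exact: (realizes_LL MC).
split; first exact: (realizes_II MC).
exact: (realizes_LI MC).
Qed.
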